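(* Let $[\mu]\in\mathbb{P}V_n$ be a critical point of $F_n:\mathbb{P}V_n\to\mathbb{R}$ with $\mathrm{M}_\mu=c_\mu I+D_\mu$ for some $c_\mu\in\mathbb{R}$ and $D_\mu\in\mathrm{Der}(\mu)$. Then there exists a constant $c>0$ such that the eigenvalues of $cD_\mu$ are integers prime to each other, say $k_1<k_2<\cdots<k_r\in\mathbb{Z}$, with multiplicities $d_1,d_2,\dots,d_r\in\mathbb{N}$. If moreover $[\mu]\in S_n$, then these integers are nonnegative.
   Context: Let $V_n=\otimes^2(\mathbb{C}^n)^*\otimes\mathbb{C}^n$ be the space of all bilinear maps $\mu:\mathbb{C}^n\times\mathbb{C}^n\to\mathbb{C}^n$. $\mathrm{GL}(n)=\mathrm{GL}(\mathbb{C}^n)$ acts on $V_n$ by $g.\mu(X,Y)=g\mu(g^{-1}X,g^{-1}Y)$, and $\mathrm{Der}(\mu)$ is the derivation algebra of $\mu$. Fix a Hermitian inner product on $\mathbb{C}^n$; it induces the Hermitian inner product $\langle\mu,\lambda\rangle=\sum_{i,j,k}\langle\mu(X_i,X_j),X_k\rangle\overline{\langle\lambda(X_i,X_j),X_k\rangle}$ on $V_n$, where $\{X_i\}$ is any orthonormal basis of $\mathbb{C}^n$. On $\mathfrak{gl}(n)$ put $(A,B)=\operatorname{tr}AB^*$, where $^*$ is the conjugate transpose with respect to the fixed inner product; $\mathrm{i}\mathfrak{u}(n)$ is the space of Hermitian operators. The moment map $m:\mathbb{P}V_n\to\mathrm{i}\mathfrak{u}(n)$ is defined by $(m([\mu]),A)=(\mathrm{d}\rho_\mu)_eA/\|\mu\|^2$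 for $A\in\mathrm{i}\mathfrak{u}(n)$, where $\rho_\mu(g)=\langle g.\mu,g.\mu\rangle$, and $F_n([\mu])=\|m([\mu])\|^2=(m([\mu]),m([\mu]))$. With $L^\mu_X(Y)=\mu(X,Y)$, $R^\mu_X(Y)=\mu(Y,X)$, set $\mathrm{M}_\mu=2\sum_iL^\mu_{X_i}(L^\mu_{X_i})^*-2\sum_i(L^\mu_{X_i})^*L^\mu_{X_i}-2\sum_i(R^\mu_{X_i})^*R^\mu_{X_i}$; one has $m([\mu])=\mathrm{M}_\mu/\|\mu\|^2$. It is known that $[\mu]$ is a critical point of $F_n$ iff $\mathrm{M}_\mu=c_\mu I+D_\mu$ with $c_\mu\in\mathbb{R}$, $D_\mu\in\mathrm{Der}(\mu)$. A (left) Leibniz algebra satisfies $x(yz)=(xy)z+y(xz)$; a symmetric Leibniz algebra satisfies in addition $(xy)z=(xz)y+x(yz)$, for all $x,y,z$. $S_n\subset\mathbb{P}V_n$ is the projectivization of the algebraic variety of all $n$-dimensional complex symmetric Leibniz algebra structures on $\mathbb{C}^n$. When $D_\mu=0$ the data are $r=1$, $k_1=0$, $d_1=n$. *)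

(* Defs.v *)
From HB Require Import structures.
From mathcomp Require Import all_boot all_order all_algebra.
From mathcomp Require Import all_classical all_reals all_analysis.
From mathcomp Require Import complex.

Set Implicit Arguments.
Unset Strict Implicit.
Unset Printing Implicit Defensive.

Import Order.TTheory GRing.Theory Num.Theory.
Import numFieldNormedType.Exports.

Local Open Scope classical_set_scope.
Local Open Scope ring_scope.
Local Open Scope complex_scope.

(* C^n is the space of column vectors, on which matrices act on the left; the
   bilinear maps V_n = (C^n)^* (x) (C^n)^* (x) C^n are curried, so that V_n
   inherits a complex vector space structure from 'Hom. *)
Definition bilin (R : realType) (n : nat) :=
  'Hom('cV[R[i]]_n, 'Hom('cV[R[i]]_n, 'cV[R[i]]_n)).

(* Linear in the first argument and conjugate-linear in the second one. *)
Definition hermitian_ip (R : realType) (n : nat) :=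
  {dot 'cV[R[i]]_n for @Num.conj R[i]}.

Section Algebra.
Variables (R : realType) (n : nat).
Local Notation C := R[i].
Implicit Types (mu : bilin R n) (g A D : 'M[C]_n) (X Y : 'cV[C]_n).

Definition act g mu : bilin R n :=
  linfun (fun X => linfun (fun Y => g *m mu (invmx g *m X) (invmx g *m Y))).

(* The functions passed to linfun in act are indeed linear. *)
Lemma actE g mu X Y :
  act g mu X Y = g *m mu (invmx g *m X) (invmx g *m Y).
Proof.
have lin2 X' : linear (fun Y' => g *m mu (invmx g *m X') (invmx g *m Y')).
  by move=> a u v; rewrite mulmxDr -scalemxAr linearP mulmxDr -scalemxAr.
pose L2 X' := GRing.isLinear.Build _ _ _ _ _ (lin2 X').
pose F2 X' : {linear 'cV[C]_n -> 'cV[C]_n} := HB.pack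
  (fun Y' => g *m mu (invmx g *m X') (invmx g *m Y')) (L2 X').
have lin1 : linear (fun X' => linfun (F2 X')).
  move=> a u v; apply/lfunP => y.
  rewrite add_lfunE scale_lfunE !lfunE /=.
  rewrite mulmxDr -scalemxAr linearP add_lfunE scale_lfunE.
  by rewrite mulmxDr -scalemxAr.
pose L1 := GRing.isLinear.Build _ _ _ _ _ lin1.
pose F1 : {linear 'cV[C]_n -> 'Hom('cV[C]_n, 'cV[C]_n)} :=
  HB.pack (fun X' => linfun (F2 X')) L1.
by rewrite /act (lfunE F1) /= (lfunE (F2 X)).
Qed.

Definition is_derivation mu D : Prop :=
  forall X Y, D *m mu X Y = mu (D *m X) Y + mu X (D *m Y).

Definition left_mult mu X : 'M[C]_n :=
  \matrix_(i, j) mu X (delta_mx j 0) i 0.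

Definition right_mult mu X : 'M[C]_n :=
  \matrix_(i, j) mu (delta_mx j 0) X i 0.

Definition left_leibniz mu : Prop :=
  forall x y z, mu x (mu y z) = mu (mu x y) z + mu y (mu x z).

Definition symmetric_leibniz mu : Prop :=
  left_leibniz mu /\
  forall x y z, mu (mu x y) z = mu (mu x z) y + mu x (mu y z).

End Algebra.

Section Hermitian.
Variables (R : realType) (n : nat) (h : hermitian_ip R n).
Local Notation C := R[i].
Implicit Types (A B : 'M[C]_n) (u v : 'cV[C]_n).

Definition gram : 'M[C]_n := \matrix_(i, j) h (delta_mx i 0) (delta_mx j 0).

Lemma gramE u v : h u v = (u^T *m gram *m map_mx Num.conj v) 0 0.
Proof.
have colE (w : 'cV[C]_n) : w = \sum_(i < n) w i 0 *: delta_mx i 0.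
  apply/matrixP => i j; rewrite (ord1 j) summxE (bigD1 i) //= !mxE !eqxx mulr1.
  rewrite big1 ?addr0 // => k ki; by rewrite !mxE eq_sym (negPf ki) mulr0.
rewrite [in LHS](colE u) [in LHS](colE v) linear_sumlz /= !mxE.
under eq_bigr do rewrite linearZl /= linear_sumr mulr_sumr.
rewrite exchange_big /=; apply: eq_bigr => j _; rewrite !mxE mulr_suml.
apply: eq_bigr => i _; rewrite linearZ /= !mxE.
by rewrite mulrA mulrAC.
Qed.

Lemma gram_unit : gram \in unitmx.
Proof.
rewrite -row_free_unit -kermx_eq0; apply/rowV0P => u /sub_kermxP u0.
apply: trmx_inj; rewrite trmx0; apply/eqP; rewrite -(dnorm_eq0 h).
by rewrite gramE trmxK u0 mul0mx mxE.
Qed.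

(* The transpose of the conjugate of A when h is the standard inner product;
   in general, the adjoint of A with respect to h, see adjP. *)
Definition adj A : 'M[C]_n :=
  map_mx Num.conj (invmx gram *m A^T *m gram).

Lemma adjP A u v : h (A *m u) v = h u (adj A *m v).
Proof.
rewrite !gramE; congr (_ 0 0); rewrite map_mxM /= trmx_mul !mulmxA.
have -> : map_mx Num.conj (adj A) = invmx gram *m A^T *m gram.
  by rewrite /adj -map_mx_comp; apply: map_mx_id => x; exact: conjCK.
by rewrite !mulmxA mulmxK ?gram_unit.
Qed.

Definition hermitian_op A : Prop := adj A = A.

(* (A, B) = tr A B^* on gl(n) *)
Definition mx_ip A B : C := \tr (A *m adj B).

End Hermitian.

Section MomentMap.
Variables (R : realType) (n : nat) (h : hermitian_ip R n).
Local Notation C := R[i].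

(* An orthonormal basis of C^n for h; nothing below depends on its choice. *)
Variable X : n.-tuple 'cV[C]_n.
Implicit Types (mu lambda : bilin R n) (g A : 'M[C]_n).

Definition bilin_ip mu lambda : C :=
  let x := tnth X in
  \sum_(i < n) \sum_(j < n) \sum_(k < n)
    h (mu (x i) (x j)) (x k) * Num.conj (h (lambda (x i) (x j)) (x k)).

(* Re only serves to view these real numbers as elements of R. *)
Definition norm2 mu : R := complex.Re (bilin_ip mu mu).

Definition rho mu g : R := norm2 (act g mu).

(* (d rho_mu)_e A; I + t A is invertible for t small enough. *)
Definition drho mu A : R :=
  derive1 (fun t : R => rho mu (1%:M + t%:C *: A)) 0.

(* The value at [mu] of the moment map, i.e., the unique Hermitian operator
   representing A |-> (d rho_mu)_e A / |mu|^2 on Hermitian operators. *)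
Definition moment mu : 'M[C]_n :=
  xget 0 [set m | hermitian_op h m /\
    forall A, hermitian_op h A -> mx_ip h m A = (drho mu A / norm2 mu)%:C].

Definition Fn mu : R := complex.Re (mx_ip h (moment mu) (moment mu)).

(* Points [mu] of PV_n are given by representatives mu != 0. As the projection
   V_n \ {0} -> PV_n is a surjective submersion, [mu] is a critical point of
   F_n iff the differential at mu of the pulled back function vanishes; t is
   real, so lambda ranges over all the real tangent directions. *)
Definition critical_point mu : Prop :=
  mu != 0 /\
  forall lambda, is_derive (0 : R) 1 (fun t : R => Fn (mu + t%:C *: lambda)) 0.

Definition Mmx mu : 'M[C]_n :=
  let L i := left_mult mu (tnth X i) in
  let S i := right_mult mu (tnth X i) in
  2 *: (\sum_(i < n) L i *m adj h (L i))
  - 2 *: (\sum_(i < n) adj h (L i) *m L i)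
  - 2 *: (\sum_(i < n) adj h (S i) *m S i).

End MomentMap.

(* Main.v *)
Require Import Defs.
From HB Require Import structures.
From mathcomp Require Import all_boot all_order all_algebra.
From mathcomp Require Import all_classical all_reals all_analysis.
From mathcomp Require Import complex.
From mathcomp Require Import ring.

(* The matrix M satisfies tr (A M) = 2 <pi (A) mu, mu>, where pi (A) mu =
   A mu (., .) - mu (A ., .) - mu (., A .); hence tr (A M) = 0 for every
   derivation A.

   Rationality: D = M - c I is self-adjoint, hence diagonalizable, with
   eigenvalues l. In a basis of eigenvectors diag w is a derivation iff
   w_k = w_i + w_j whenever mu has a nonzero structure constant (i, j, k), a
   system of equations with integer coefficients. The vector l solves this
   system, and l + c (1, ..., 1) is orthogonal to all its solutions, because
   tr (diag w M) = 0. So l is -c times the orthogonal projection of (1, ..., 1)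
   onto a rational subspace; moreover c < 0.

   Nonnegativity: for D v = l v, the left and right multiplications A by v are
   derivations of a symmetric Leibniz algebra, and [D, A] = l A. Then
   l tr (A A') = tr ([M, A] A') = tr (M [A, A']) = 2 |pi (A') mu|^2 >= 0, where
   A' is the adjoint of A. If both multiplications vanish, <M v, v> is a sum of
   squares, so c + l >= 0 and l >= - c > 0. *)

Import Order.TTheory GRing.Theory Num.Theory.
Local Open Scope ring_scope.
Local Open Scope complex_scope.

(** * Linear algebra over fields, rational projections, primitive integer vectors *)

Lemma char_poly_conj_diag (F : fieldType) n (P : 'M[F]_n) (l : 'rV[F]_n) :
  P \in unitmx ->
  char_poly (invmx P *m diag_mx l *m P) = \prod_(i < n) ('X - (l 0 i)%:P).
Proof.
move=> Pu; have -> : \prod_(i < n) ('X - (l 0 i)%:P) = char_poly (diag_mx l).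
  rewrite char_poly_trig ?diag_mx_is_trig //.
  by apply: eq_bigr => i _; rewrite mxE eqxx mulr1n.
have PVP : map_mx polyC (invmx P) *m map_mx polyC P = 1%:M.
  by rewrite -map_mxM mulVmx // map_mx1.
rewrite /char_poly /char_poly_mx.
have -> : 'X%:M - map_mx polyC (invmx P *m diag_mx l *m P) =
    map_mx polyC (invmx P) *m ('X%:M - map_mx polyC (diag_mx l)) *m
    map_mx polyC P.
  rewrite !map_mxM /= mulmxBr mulmxBl; congr (_ - _).
  by rewrite mul_mx_scalar -scalemxAl PVP scalemx1.
by rewrite !det_mulmx mulrAC -det_mulmx PVP det1 mul1r.
Qed.

(** A vector [v] in both the kernel of [B] and the row space of [B^T] has [v *m v^T = 0], a sum of
    squares, so [v = 0]; the two ranks add up to [n]. *)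
Lemma ker_trmx_decomp (F : realFieldType) m n (B : 'M[F]_(n, m)) (u : 'rV_n) :
  exists x z, x *m B = 0 /\ u = x + z *m B^T.
Proof.
have cap0 : (kermx B :&: B^T)%MS = 0.
  apply/eqP; rewrite -submx0; apply/rV_subP => v.
  rewrite sub_capmx => /andP[/sub_kermxP vB /submxP[w vw]].
  rewrite submx0.
  have vv : v *m v^T = 0 by rewrite {2}vw trmx_mul trmxK mulmxA vB mul0mx.
  move/matrixP/(_ 0 0): vv; rewrite !mxE => /eqP.
  rewrite psumr_eq0 => [/allP v0|i _]; last by rewrite mxE -expr2 sqr_ge0.
  apply/eqP/rowP => i; have := v0 i (mem_index_enum _).
  by rewrite !mxE mulf_eq0 orbb => /eqP.
have full : row_full (kermx B + B^T)%MS.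
  rewrite /row_full mxrank_disjoint_sum // mxrank_ker mxrank_tr subnK //.
  exact: rank_leq_row.
have /sub_addsmxP[[y z] /= ->] := submx_full u full.
exists (y *m kermx B), z; split=> //.
by rewrite -mulmxA mulmx_ker mulmx0.
Qed.

(** Here [x] is the projection of (-1, ..., -1) onto the kernel, computed over [rat]. The error
    [w = l - c *: x'] lies in the kernel and is orthogonal to it. Since orthogonality is bilinear,
    [w] is paired with its conjugate [v], again in the kernel because [B] is rational; this makes
    the sum of the |w_i|^2 vanish. *)
Lemma rational_kernel_vector (C : numClosedFieldType) m n
    (B : 'M[rat]_(n, m)) (l : 'rV[C]_n) (c : C) :
  l *m map_mx ratr B = 0 ->
  (forall w : 'rV_n, w *m map_mx ratr B = 0 ->
    (l + const_mx c) *m w^T = 0) ->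
  exists x : 'rV[rat]_n, l = c *: map_mx ratr x.
Proof.
move=> lB orth; have [x [z [xB e1]]] := ker_trmx_decomp _ _ _ B (const_mx (-1)).
exists x; set x' := map_mx ratr x : 'rV[C]_n.
pose w := l - c *: x'.
have x'B : x' *m map_mx ratr B = 0 by rewrite -map_mxM xB map_mx0.
have wB : w *m map_mx ratr B = 0.
  by rewrite mulmxBl lB -scalemxAl x'B scaler0 subr0.
pose v := map_mx Num.conj w.
have vB : v *m map_mx ratr B = 0.
  have -> : map_mx ratr B = map_mx Num.conj (map_mx ratr B : 'M[C]_(n, m)).
    by apply/matrixP => i j; rewrite !mxE fmorph_rat.
  by rewrite -map_mxM wB map_mx0.
have xv : (x' + const_mx 1) *m v^T = 0.
  have -> : x' + const_mx 1 = - (map_mx ratr z *m (map_mx ratr B)^T).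
    rewrite map_trmx -map_mxM; apply/rowP => i.
    have /rowP/(_ i) := e1; rewrite !mxE => e2.
    have {e2} -> : x 0 i = -1 - \sum_j z 0 j * B^T j i by rewrite e2 addrK.
    by rewrite !rmorphB /= rmorphN1 addrC addrA subrr add0r.
  by rewrite mulNmx -mulmxA -trmx_mul vB trmx0 mulmx0 oppr0.
have wv : w *m v^T = 0.
  have -> : w = l + const_mx c - c *: (x' + const_mx 1).
    by apply/rowP => i; rewrite !mxE; ring.
  by rewrite mulmxBl orth // -scalemxAl xv scaler0 subr0.
apply/eqP; rewrite -subr_eq0 -/w; apply/eqP/rowP => i.
move/matrixP/(_ 0 0): wv; rewrite !mxE => /eqP.
rewrite psumr_eq0 => [/allP v0|j _]; last by rewrite !mxE mul_conjC_ge0.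
have := v0 i (mem_index_enum _).
by rewrite !mxE mul_conjC_eq0 => /eqP.
Qed.

(** Clear the common denominator [d], then divide by the gcd [g] of the numerators [y i]. *)
Lemma rat_primitive_integer n (x : 'I_n -> rat) :
  exists (q : rat) (z : 'I_n -> int),
    [/\ 0 < q, forall i, x i = q * (z i)%:~R &
        (exists i, x i != 0) -> \big[gcdn/0%N]_(i < n) `|z i|%N = 1%N].
Proof.
pose d := \prod_(i < n) denq (x i).
have d_gt0 : 0 < d by apply: prodr_gt0 => i _; exact: denq_gt0.
pose y i := numq (x i) * \prod_(j < n | j != i) denq (x j).
have dx i : x i = (y i)%:~R / d%:~R.
  have -> : d = denq (x i) * \prod_(j < n | j != i) denq (x j).
    by rewrite /d (bigD1 i).
  rewrite /y !intrM -{1}(divq_num_den (x i)).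
  rewrite -mulf_div divff ?mulr1 // intr_eq0.
  by apply/prodf_neq0 => j _; rewrite denq_neq0.
pose g := \big[gcdn/0%N]_(i < n) `|y i|%N.
have gy i : (g%:Z %| y i)%Z by rewrite dvdzE (@biggcdn_inf _ i).
(* If [g = 0] then [x] is zero, and [q = 1], [z = 0] will do. *)
have [g0|g_gt0] := posnP g.
  exists 1, (fun=> 0); have x0 i : x i = 0.
    by move: (gy i); rewrite g0 dvd0z dx => /eqP ->; rewrite mul0r.
  by split=> [//|j|[j]]; rewrite x0 ?mulr0 ?eqxx.
exists (g%:Z%:~R / d%:~R), (fun i => (y i %/ g)%Z); split=> [|i|_].
- by apply: divr_gt0; rewrite ltr0z.
- by rewrite dx -{1}(divzK (gy i)) intrM -mulrA mulrC.
(* If [e] is the gcd of the quotients, [e * g] divides every [y i], hence divides [g]. *)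
set e := \big[_/_]_(i < n) _.
have eg : (e * g %| g)%N.
  apply/dvdn_biggcdP => i _; rewrite -(divzK (gy i)) abszM dvdn_mul //.
  exact: (@biggcdn_inf _ i).
by apply/eqP; rewrite -dvdn1 -(dvdn_pmul2r g_gt0) mul1n.
Qed.

(** The [k i] are the distinct values of [z] in sorted order, and [d i] counts the occurrences of
    [k i]. *)
Lemma prod_XsubC_group_int (F : comNzRingType) n (z : 'I_n -> int) :
  exists (r : nat) (k : 'I_r -> int) (d : 'I_r -> nat),
    [/\ forall i j : 'I_r, (i < j)%N -> k i < k j,
        forall i : 'I_r, (0 < d i)%N,
        \prod_(i < n) ('X - ((z i)%:~R)%:P) =
          \prod_(i < r) ('X - ((k i)%:~R)%:P) ^+ d i :> {poly F},
        forall i, exists j, z j = k i & forall j, exists i, k i = z j].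
Proof.
pose s := [seq z i | i <- enum 'I_n].
pose t := sort <=%O (undup s).
have ts : t =i s by move=> a; rewrite mem_sort mem_undup.
have tlt : sorted <%O t by rewrite sort_lt_sorted undup_uniq.
have zs j : z j \in s by rewrite map_f // mem_enum.
exists (size t), (fun i => tnth (in_tuple t) i),
  (fun i => count_mem (tnth (in_tuple t) i) s); split.
- move=> i j ij; rewrite !(tnth_nth 0) /=.
  by have /= -> := lt_sorted_ltn_nth 0 tlt; rewrite ?inE ?ltn_ord.
- by move=> i; rewrite -has_count has_pred1 -ts mem_tnth.
- have -> : \prod_(i < n) ('X - ((z i)%:~R)%:P) =
      \prod_(a <- s) ('X - (a%:~R)%:P) :> {poly F}.
    by rewrite big_map big_enum.
  rewrite -big_undup_iterop_count -(perm_big _ (permEl (perm_sort <=%O _))) /=.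
  by rewrite big_tnth; apply: eq_bigr => i _; rewrite -/t.
- move=> i; have : tnth (in_tuple t) i \in s by rewrite -ts mem_tnth.
  by case/mapP => j _ ->; exists j.
move=> j; have /(nthP 0)[i it e] : z j \in t by rewrite ts.
by exists (Ordinal it); rewrite (tnth_nth 0).
Qed.

(** * Adjoints with respect to the Hermitian form *)

Section HermitianForm.
Variables (R : realType) (n : nat) (h : hermitian_ip R n).
Local Notation C := R[i].
Implicit Types (A B : 'M[C]_n) (u v : 'cV[C]_n).

Lemma form_conj u v : h u v = Num.conj (h v u).
Proof. by rewrite hermC expr0 mul1r. Qed.

Lemma adjPl A u v : h (adj h A *m u) v = h u (A *m v).
Proof. by rewrite form_conj -adjP -form_conj. Qed.

Lemma form_mulmx_inj A B :
  (forall u v, h u (A *m v) = h u (B *m v)) -> A = B.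
Proof.
move=> AB; apply/matrixP => i j; apply/eqP; rewrite -subr_eq0; apply/eqP.
have : (A - B) *m delta_mx j 0 = 0 :> 'cV_n.
  apply/eqP; rewrite -(dnorm_eq0 h).
  by rewrite [X in h _ X]mulmxBl linearBr /= AB subrr.
by move/matrixP/(_ i 0); rewrite -colE !mxE.
Qed.

Lemma adjK A : adj h (adj h A) = A.
Proof. by apply: form_mulmx_inj => u v; rewrite -adjP adjPl. Qed.

Lemma adjM A B : adj h (A *m B) = adj h B *m adj h A.
Proof.
by apply: form_mulmx_inj => u v; rewrite -adjP -!mulmxA -!adjP.
Qed.

Lemma adjD A B : adj h (A + B) = adj h A + adj h B.
Proof.
apply: form_mulmx_inj => u v.
by rewrite -adjP !mulmxDl linearDr linearDl /= !adjP.
Qed.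

Lemma adj_scale (a : C) A : adj h (a *: A) = Num.conj a *: adj h A.
Proof.
apply: form_mulmx_inj => u v.
rewrite -adjP -!scalemxAl linearZl linearZr /= adjP.
by rewrite conjCK.
Qed.

Lemma adjN A : adj h (- A) = - adj h A.
Proof. by rewrite -scaleN1r adj_scale conjCN1 scaleN1r. Qed.

Lemma adj_sum I (r : seq I) (F : I -> 'M[C]_n) :
  adj h (\sum_(i <- r) F i) = \sum_(i <- r) adj h (F i).
Proof.
apply: (big_morph (adj h) adjD).
by rewrite -[X in adj h X](scale0r 0) adj_scale conjC0 scale0r.
Qed.

Lemma form_gramE p q (A : 'M[C]_(n, p)) (B : 'M[C]_(n, q)) i j :
  (A^T *m gram h *m map_mx Num.conj B) i j = h (col i A) (col j B).
Proof.
have entryE (N : 'M[C]_(p, q)) :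
    N i j = (delta_mx 0 i *m N *m delta_mx j 0 : 'M[C]_1) 0 0.
  by rewrite -rowE -colE !mxE.
rewrite gramE !colE trmx_mul map_mxM map_delta_mx trmx_delta entryE.
by rewrite !mulmxA.
Qed.
End HermitianForm.

(** * Traces in an orthonormal basis and the spectral theorem *)

Section OrthonormalBasis.
Variables (R : realType) (n : nat) (h : hermitian_ip R n).
Local Notation C := R[i].
Variables (X : n.-tuple 'cV[C]_n) (hX : orthonormal h X).
Implicit Types (A B : 'M[C]_n) (u v : 'cV[C]_n).
Let x := tnth X.

Definition basis_mx : 'M[C]_n := \matrix_(i, j) x j i 0.

Lemma col_basis_mx i : col i basis_mx = x i.
Proof. by apply/matrixP => j k; rewrite !mxE (ord1 k). Qed.

Lemma col_mul_basis_mx A i : col i (A *m basis_mx) = A *m x i.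
Proof. by rewrite -col_basis_mx !colE mulmxA. Qed.

Lemma form_basis i j : h (x i) (x j) = (i == j)%:R.
Proof.
have /orthonormalP[uX oX] := hX; rewrite oX ?mem_tnth //.
by congr (_%:R); rewrite /x (inj_eq (tuple_uniqP X uX)).
Qed.

Lemma gram_basis_mx :
  basis_mx^T *m gram h *m map_mx Num.conj basis_mx = 1%:M.
Proof.
by apply/matrixP => i j; rewrite form_gramE !col_basis_mx form_basis mxE.
Qed.

Lemma basis_mx_unit : basis_mx \in unitmx.
Proof.
have := gram_basis_mx; rewrite -mulmxA => /mulmx1_unit[].
by rewrite unitmx_tr.
Qed.

Lemma mxtrace_form A : \tr A = \sum_i h (A *m x i) (x i).
Proof.
(* Orthonormality gives a one-sided inverse, hence a two-sided one; the reversed product can be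
   inserted into the trace. *)
have /mulmx1C e : basis_mx^T *m (gram h *m map_mx Num.conj basis_mx) = 1%:M.
  by rewrite mulmxA gram_basis_mx.
rewrite -mxtrace_tr -[A^T]mul1mx -e -mulmxA mxtrace_mulC.
apply: eq_bigr => i _; rewrite -trmx_mul mulmxA form_gramE col_mul_basis_mx.
by rewrite col_basis_mx.
Qed.

Lemma mxtrace_adj_mul A B :
  \tr (adj h B *m A) = \sum_i h (A *m x i) (B *m x i).
Proof.
by rewrite mxtrace_form; apply: eq_bigr => i _; rewrite -mulmxA adjPl.
Qed.

Lemma mxtrace_adj_ge0 A : 0 <= \tr (A *m adj h A).
Proof.
rewrite mxtrace_mulC mxtrace_adj_mul.
by apply: sumr_ge0 => i _; exact: dnorm_ge0.
Qed.

Lemma basis_mulmx_inj A : (forall i, A *m x i = 0) -> A = 0.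
Proof.
move=> A0; have : A *m basis_mx = 0.
  apply/matrixP => i j; have := congr1 (fun v : 'cV_n => v i 0) (A0 j).
  by rewrite -col_mul_basis_mx !mxE.
by move=> e; rewrite -[A](mulmxK basis_mx_unit) e mul0mx.
Qed.

Lemma mxtrace_adj_eq0 A : (\tr (A *m adj h A) == 0) = (A == 0).
Proof.
apply/eqP/eqP => [|->]; last by rewrite mul0mx mxtrace0.
rewrite mxtrace_mulC mxtrace_adj_mul => /eqP.
rewrite psumr_eq0 => [/allP A0|i _]; last exact: dnorm_ge0.
apply: basis_mulmx_inj => i; apply/eqP; rewrite -(dnorm_eq0 h).
exact: A0 (mem_index_enum i).
Qed.

(** In the orthonormal basis [A] becomes a matrix [B] whose transpose is its conjugate. So [B] is
    normal and the spectral theorem for the standard inner product applies. *)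
Lemma selfadjoint_diag A : adj h A = A ->
  exists (Q : 'M[C]_n) (l : 'rV[C]_n),
    Q \in unitmx /\ A = invmx Q *m diag_mx l *m Q.
Proof.
move=> Aadj; have Pu := basis_mx_unit; set P := basis_mx in Pu.
pose B := invmx P *m A *m P.
have PB : P *m B = A *m P by rewrite !mulmxA mulmxV // mul1mx.
have BT : B^T = map_mx Num.conj B.
  (* [B^T] and the conjugate of [B] have entries h (A x_i, x_j) and h (x_i, A x_j), which agree by
     self-adjointness. *)
  have <- : (A *m P)^T *m gram h *m map_mx Num.conj P = B^T.
    rewrite -PB trmx_mul -!mulmxA [P^T *m _]mulmxA.
    by rewrite gram_basis_mx mulmx1.
  have <- : P^T *m gram h *m map_mx Num.conj (A *m P) = map_mx Num.conj B.
    by rewrite -PB map_mxM mulmxA gram_basis_mx mul1mx.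
  apply/matrixP => i j; rewrite !form_gramE !colE -!mulmxA.
  by rewrite adjP Aadj.
have /orthomx_spectralP : B \is normalmx.
  apply/normalmxP; rewrite BT -map_mx_comp map_mx_id //.
  exact: conjCK.
set V := spectralmx B => eB.
have Vu : V \in unitmx by exact: spectral_unit.
exists (V *m invmx P), (spectral_diag B); split.
  by rewrite unitmx_mul Vu unitmx_inv.
have -> : invmx (V *m invmx P) = P *m invmx V.
  apply: (can_inj (mulKmx (_ : V *m invmx P \in unitmx))).
    by rewrite unitmx_mul Vu unitmx_inv.
  by rewrite mulmxV ?unitmx_mul ?Vu ?unitmx_inv // -mulmxA [_ *m (P *m _)]mulmxA
    mulVmx // mul1mx mulmxV.
have -> : P *m invmx V *m diag_mx (spectral_diag B) *m (V *m invmx P) =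
    P *m (invmx V *m diag_mx (spectral_diag B) *m V) *m invmx P.
  by rewrite !mulmxA.
by rewrite -eB PB mulmxK.
Qed.

End OrthonormalBasis.

(** * The matrix M and the infinitesimal action of gl(n) *)

Section Structure.
Variables (R : realType) (n : nat) (h : hermitian_ip R n).
Local Notation C := R[i].
Variables (X : n.-tuple 'cV[C]_n) (hX : orthonormal h X) (mu : bilin R n).
Implicit Types (A B : 'M[C]_n) (u v : 'cV[C]_n).
Let x := tnth X.
Local Notation L := (left_mult mu).
Local Notation S := (right_mult mu).
Local Notation M := (Mmx h X mu).

Lemma mulmx_delta_sum m (F : 'M[C]_(m, n)) v :
  F *m v = \sum_j v j 0 *: (F *m delta_mx j 0).
Proof.
rewrite {1}[v]matrix_sum_delta mulmx_sumr; apply: eq_bigr => j _.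
by rewrite big_ord1 scalemxAr.
Qed.

Lemma cV_sum_delta v : v = \sum_j v j 0 *: delta_mx j 0.
Proof.
by rewrite -[LHS]mul1mx mulmx_delta_sum; under eq_bigr do rewrite mul1mx.
Qed.

Lemma left_multE u v : L u *m v = mu u v.
Proof.
rewrite {2}(cV_sum_delta v) linear_sum mulmx_delta_sum; apply: eq_bigr => j _.
rewrite linearZ /= -colE; congr (_ *: _); apply/matrixP => i k.
by rewrite !mxE (ord1 k).
Qed.

Lemma right_multE u v : S u *m v = mu v u.
Proof.
rewrite {2}(cV_sum_delta v) linear_sum sum_lfunE mulmx_delta_sum.
apply: eq_bigr => j _.
rewrite linearZ scale_lfunE /= -colE; congr (_ *: _); apply/matrixP => i k.
by rewrite !mxE (ord1 k).
Qed.

Lemma bilinBl u1 u2 v : mu (u1 - u2) v = mu u1 v - mu u2 v.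
Proof. by rewrite linearB add_lfunE opp_lfunE. Qed.

Lemma bilinBr u v1 v2 : mu u (v1 - v2) = mu u v1 - mu u v2.
Proof. exact: linearB. Qed.

(** This is [pi (A) mu], the differential at the identity of g |-> [act g mu]. *)
Definition gl_action A u v : 'cV[C]_n :=
  A *m mu u v - mu (A *m u) v - mu u (A *m v).

Lemma gl_action_eq0 A u v : is_derivation mu A -> gl_action A u v = 0.
Proof. by move=> dA; rewrite /gl_action dA addrAC addrK subrr. Qed.

(** The three sums in M match the three terms of [gl_action]: by cyclicity of the trace, L L^* puts
    [A] on the value of [mu], L^* L on the second argument, and S^* S on the first. *)
Lemma mxtrace_mul_Mmx A :
  \tr (A *m M) =
    2 * \sum_i \sum_j h (gl_action A (x i) (x j)) (mu (x i) (x j)).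
Proof.
have e1 : \tr (A *m \sum_i L (x i) *m adj h (L (x i))) =
    \sum_i \sum_j h (A *m mu (x i) (x j)) (mu (x i) (x j)).
  rewrite mulmx_sumr raddf_sum; apply: eq_bigr => i _ /=.
  rewrite mulmxA mxtrace_mulC (mxtrace_adj_mul _ _ _ _ hX).
  by apply: eq_bigr => j _; rewrite -mulmxA !left_multE.
have e2 : \tr (A *m \sum_i adj h (L (x i)) *m L (x i)) =
    \sum_i \sum_j h (mu (x i) (A *m x j)) (mu (x i) (x j)).
  rewrite mulmx_sumr raddf_sum; apply: eq_bigr => i _ /=.
  rewrite mxtrace_mulC -mulmxA (mxtrace_adj_mul _ _ _ _ hX).
  by apply: eq_bigr => j _; rewrite -mulmxA !left_multE.
have e3 : \tr (A *m \sum_i adj h (S (x i)) *m S (x i)) =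
    \sum_i \sum_j h (mu (A *m x i) (x j)) (mu (x i) (x j)).
  rewrite mulmx_sumr raddf_sum [RHS]exchange_big; apply: eq_bigr => i _ /=.
  rewrite mxtrace_mulC -mulmxA (mxtrace_adj_mul _ _ _ _ hX).
  by apply: eq_bigr => j _; rewrite -mulmxA !right_multE.
rewrite /Mmx !mulmxBr -!scalemxAr !raddfB /= !mxtraceZ e1 e2 e3 -!mulrBr.
congr (_ * _); rewrite -!sumrB; apply: eq_bigr => i _.
rewrite -!sumrB; apply: eq_bigr => j _.
by rewrite /gl_action !linearBl /= addrAC.
Qed.

Lemma mxtrace_derivation_Mmx A : is_derivation mu A -> \tr (A *m M) = 0.
Proof.
move=> dA; rewrite mxtrace_mul_Mmx big1 ?mulr0 // => i _; apply: big1 => j _.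
by rewrite gl_action_eq0 // linear0l.
Qed.

Lemma adj_Mmx : adj h M = M.
Proof.
have adj2 (F : 'I_n -> 'M[C]_n) : (forall i, adj h (F i) = F i) ->
    adj h (2 *: \sum_i F i) = 2 *: \sum_i F i.
  move=> adjF; rewrite adj_scale conjC_nat adj_sum; congr (_ *: _).
  by apply: eq_bigr => i _; rewrite adjF.
by rewrite /Mmx !adjD !adjN !adj2 // => i; rewrite adjM adjK.
Qed.

(** The identity acts by mu - mu - mu = - mu, so the trace is -2 |mu|^2. *)
Lemma mxtrace_Mmx_lt0 : mu != 0 -> \tr M < 0.
Proof.
move=> mu0; rewrite -[M]mul1mx mxtrace_mul_Mmx.
have e i j : h (gl_action 1%:M (x i) (x j)) (mu (x i) (x j)) =
    - h (mu (x i) (x j)) (mu (x i) (x j)).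
  by rewrite /gl_action !mul1mx subrr sub0r linearNl.
under eq_bigr do under eq_bigr do rewrite e.
under eq_bigr do rewrite sumrN.
rewrite sumrN mulrN oppr_lt0 pmulr_rgt0 // lt_def.
apply/andP; split; last first.
  by apply: sumr_ge0 => i _; apply: sumr_ge0 => j _; exact: dnorm_ge0.
apply: contra mu0; rewrite psumr_eq0 => [/allP mu0|i _]; last first.
  by apply: sumr_ge0 => j _; exact: dnorm_ge0.
have {}mu0 i j : mu (x i) (x j) = 0.
  have := mu0 i (mem_index_enum i); rewrite /= psumr_eq0 => [/allP|k _].
    by move=> /(_ j (mem_index_enum j)); rewrite /= dnorm_eq0 => /eqP.
  exact: dnorm_ge0.
apply/eqP/lfunP => u; apply/lfunP => v; rewrite !zero_lfunE.
have Lx i : L (x i) = 0.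
  by apply: (basis_mulmx_inj _ _ _ _ hX) => j; rewrite left_multE.
rewrite -right_multE (_ : S v = 0) ?mul0mx //.
apply: (basis_mulmx_inj _ _ _ _ hX) => i.
by rewrite right_multE -left_multE Lx mul0mx.
Qed.

(* With pi the action of gl(n) on bilinear maps and A' the adjoint of A,
   tr (M [A, A']) = 2 <pi [A, A'] mu, mu> = 2 |pi A' mu|^2 - 2 |pi A mu|^2. *)
Lemma mxtrace_commutator_Mmx_ge0 A : is_derivation mu A ->
  0 <= \tr ((A *m adj h A - adj h A *m A) *m M).
Proof.
move=> dA; rewrite mxtrace_mul_Mmx; set B := adj h A.
set nu := gl_action B.
(* [Nl u] and [Nr u] are the left and right multiplications of the bilinear map [nu], which turns
   sums over one argument into traces. *)
pose Nl u := B *m L u - L (B *m u) - L u *m B.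
pose Nr u := B *m S u - S u *m B - S (B *m u).
have NlE u v : Nl u *m v = nu u v.
  by rewrite !mulmxBl -!mulmxA !left_multE.
have NrE u v : Nr u *m v = nu v u.
  by rewrite !mulmxBl -!mulmxA !right_multE.
(* pi [A, B] mu = pi A (pi B mu), because pi A mu = 0. *)
have comm u v : gl_action (A *m B - B *m A) u v =
    A *m nu u v - nu (A *m u) v - nu u (A *m v).
  rewrite /nu /gl_action !mulmxBl -!mulmxA (dA u v) !(mulmxDr, mulmxN) !dA.
  rewrite !bilinBl !bilinBr.
  move: (A *m (B *m mu u v)) (B *m mu (A *m u) v) (B *m mu u (A *m v)).
  move: (mu (A *m (B *m u)) v) (mu (B *m (A *m u)) v) (mu (B *m u) (A *m v)).
  move: (mu u (A *m (B *m v))) (mu u (B *m (A *m v))) (mu (A *m u) (B *m v)).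
  move=> m1 m2 m3 m4 m5 m6 m7 m8 m9.
  by apply/matrixP => i j; rewrite !mxE; ring.
(* Both sides are traces: tr (Q^* P A) = tr (A Q^* P), and A Q^* is the adjoint of Q B. *)
have shift P Q : \sum_j h (P *m (A *m x j)) (Q *m x j) =
    \sum_j h (P *m x j) (Q *m (B *m x j)).
  under eq_bigr do rewrite mulmxA.
  under [RHS]eq_bigr do rewrite mulmxA.
  rewrite -!(mxtrace_adj_mul _ _ _ _ hX) adjM /B adjK.
  by rewrite mulmxA mxtrace_mulC mulmxA.
apply: mulr_ge0 => //.
suff -> : \sum_i \sum_j h (gl_action (A *m B - B *m A) (x i) (x j))
    (mu (x i) (x j)) = \sum_i \sum_j h (nu (x i) (x j)) (nu (x i) (x j)).
  by apply: sumr_ge0 => i _; apply: sumr_ge0 => j _; exact: dnorm_ge0.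
have e2 : \sum_i \sum_j h (nu (A *m x i) (x j)) (mu (x i) (x j)) =
    \sum_i \sum_j h (nu (x i) (x j)) (mu (B *m x i) (x j)).
  rewrite exchange_big [RHS]exchange_big; apply: eq_bigr => j _ /=.
  under eq_bigr do rewrite -NrE -right_multE.
  under [RHS]eq_bigr do rewrite -NrE -right_multE.
  exact: shift.
have e3 : \sum_i \sum_j h (nu (x i) (A *m x j)) (mu (x i) (x j)) =
    \sum_i \sum_j h (nu (x i) (x j)) (mu (x i) (B *m x j)).
  apply: eq_bigr => i _ /=.
  under eq_bigr do rewrite -NlE -left_multE.
  under [RHS]eq_bigr do rewrite -NlE -left_multE.
  exact: shift.
(* This expands <pi A nu, mu>; moving [A] across in each term yields <nu, pi B mu> = |nu|^2. *)
transitivity (\sum_i \sum_j h (A *m nu (x i) (x j)) (mu (x i) (x j)) -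
   \sum_i \sum_j h (nu (A *m x i) (x j)) (mu (x i) (x j)) -
   \sum_i \sum_j h (nu (x i) (A *m x j)) (mu (x i) (x j))).
  rewrite -!sumrB; apply: eq_bigr => i _; rewrite -!sumrB.
  by apply: eq_bigr => j _; rewrite comm !linearBl.
rewrite e2 e3 -!sumrB; apply: eq_bigr => i _; rewrite -!sumrB.
by apply: eq_bigr => j _; rewrite adjP -!linearBr.
Qed.

End Structure.

(** * Sign of c and of the eigenvalues of D *)

Section Eigenvalues.
Variables (R : realType) (n : nat) (h : hermitian_ip R n).
Local Notation C := R[i].
Variables (X : n.-tuple 'cV[C]_n) (hX : orthonormal h X) (mu : bilin R n).
Hypothesis mu_neq0 : mu != 0.
Variables (c : R) (D : 'M[C]_n).
Hypotheses (dD : is_derivation mu D) (MD : Mmx h X mu = c%:C%:M + D).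
Local Notation L := (left_mult mu).
Local Notation S := (right_mult mu).
Local Notation M := (Mmx h X mu).

(** As M is self-adjoint and nonzero, 0 < tr (M M) = c tr M + tr (D M) = c tr M, while tr M < 0. *)
Lemma critical_const_lt0 : c < 0.
Proof.
have trM := mxtrace_Mmx_lt0 _ _ _ _ hX _ mu_neq0.
have : 0 < \tr (M *m adj h M).
  rewrite lt_def (mxtrace_adj_eq0 _ _ _ _ hX) (mxtrace_adj_ge0 _ _ _ _ hX) andbT.
  by apply: contraTneq trM => ->; rewrite mxtrace0 ltxx.
rewrite adj_Mmx {1}MD mulmxDl raddfD /=.
rewrite (mxtrace_derivation_Mmx _ _ _ _ hX _ _ dD) addr0.
by rewrite mul_scalar_mx mxtraceZ nmulr_lgt0 // -ltcR.
Qed.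

Lemma adj_critical_derivation : adj h D = D.
Proof.
have -> : D = M - c%:C%:M by rewrite MD addrC addKr.
rewrite adjD adjN adj_Mmx; congr (_ - _).
rewrite -scalemx1 adj_scale.
have -> : adj h 1%:M = 1%:M.
  by apply: (form_mulmx_inj _ _ h) => u v; rewrite -adjP !mul1mx.
by congr (_ *: _); exact: conjc_real.
Qed.

Lemma derivation_eigenmx_ge0 (A : 'M[C]_n) (l : C) : is_derivation mu A ->
  D *m A - A *m D = l *: A -> A != 0 -> 0 <= l.
Proof.
move=> dA DA A0; have := mxtrace_commutator_Mmx_ge0 _ _ h _ hX _ _ dA.
have trC (B N : 'M[C]_n) :
    \tr ((A *m B - B *m A) *m N) = \tr ((N *m A - A *m N) *m B).
  rewrite !mulmxBl !(raddfB (@mxtrace C n)) /= mxtrace_mulC mulmxA.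
  by rewrite -[B *m A *m N]mulmxA [\tr (B *m _)]mxtrace_mulC.
have MA : M *m A - A *m M = D *m A - A *m D.
  rewrite MD mulmxDl mulmxDr mul_scalar_mx mul_mx_scalar.
  by rewrite opprD addrACA subrr add0r.
rewrite trC MA DA -scalemxAl mxtraceZ pmulr_lge0 //.
by rewrite lt_def (mxtrace_adj_eq0 _ _ _ _ hX) A0 (mxtrace_adj_ge0 _ _ _ _ hX).
Qed.

Lemma symmetric_leibniz_eigenvalue_ge0 (v : 'cV[C]_n) (l : C) :
  symmetric_leibniz mu -> v != 0 -> D *m v = l *: v -> 0 <= l.
Proof.
case=> left_mu right_mu v0 Dv.
(* Each of the two Leibniz identities says that one kind of multiplication is a derivation. *)
have dL : is_derivation mu (L v).
  by move=> y z; rewrite !left_multE left_mu.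
have dS : is_derivation mu (S v).
  by move=> y z; rewrite !right_multE right_mu.
(* Since [D] is a derivation, [D, L v] = L (D v), and likewise for [S]. *)
have DL : D *m L v - L v *m D = l *: L v.
  apply: (form_mulmx_inj _ _ h) => u w; congr (h _ _).
  rewrite mulmxBl -!mulmxA !left_multE dD Dv addrK.
  by rewrite -scalemxAl left_multE linearZ scale_lfunE.
have DS : D *m S v - S v *m D = l *: S v.
  apply: (form_mulmx_inj _ _ h) => u w; congr (h _ _).
  rewrite mulmxBl -!mulmxA !right_multE dD Dv addrC addKr.
  by rewrite -scalemxAl right_multE linearZ.
have [Lv0|] := eqVneq (L v) 0; last exact: derivation_eigenmx_ge0 DL.
have [Sv0|] := eqVneq (S v) 0; last exact: derivation_eigenmx_ge0 DS.
(* Now every [L u] and [S u] kills [v], so only the terms L L^* of M contribute, each a squared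
   norm. *)
have Mv : 0 <= h (M *m v) v.
  have L0 u : L u *m v = 0 by rewrite left_multE -right_multE Sv0 mul0mx.
  have S0 u : S u *m v = 0 by rewrite right_multE -left_multE Lv0 mul0mx.
  rewrite /Mmx !mulmxBl -!scalemxAl !mulmx_suml.
  have killed (F : 'I_n -> 'M[C]_n) : (forall i, F i *m v = 0) ->
      \sum_i adj h (F i) *m F i *m v = 0.
    by move=> F0; apply: big1 => i _; rewrite -mulmxA F0 mulmx0.
  rewrite !killed //.
  rewrite scaler0 !subr0 linearZl /= mulr_ge0 // linear_sumlz.
  apply: sumr_ge0 => i _.
  by rewrite -mulmxA /= adjP dnorm_ge0.
rewrite MD mulmxDl Dv mul_scalar_mx -scalerDl linearZl /= in Mv.
rewrite pmulr_lge0 ?dnorm_gt0 // in Mv.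
have c0 : c%:C <= 0 by rewrite lecR ltW ?critical_const_lt0.
by rewrite -(lerD2l c%:C) addr0 (le_trans c0).
Qed.

End Eigenvalues.

(** * Derivations that are diagonal in a given basis *)

Section DiagonalDerivations.
Variables (R : realType) (n : nat) (mu : bilin R n).
Local Notation C := R[i].
Variables (Q : 'M[C]_n) (Qu : Q \in unitmx).
(** The [v i] form the basis of eigenvectors, and [m i j k] are the structure constants of [mu] in
    it. *)
Let v i := col i (invmx Q).
Let m i j k := (Q *m mu (v i) (v j)) k 0.

Lemma mul_diag_eigenvector (l : 'rV[C]_n) i :
  invmx Q *m diag_mx l *m Q *m v i = l 0 i *: v i.
Proof.
rewrite /v colE -!mulmxA mulKVmx // scalemxAr; congr (_ *m _).
by apply/matrixP => a b; rewrite mul_diag_mx !mxE (ord1 b);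
  case: eqP => [->|_]; rewrite ?mulr0.
Qed.

(** On [v i], [v j], the k-th coordinates of the two sides of the derivation rule are l_k m_ijk and
    (l_i + l_j) m_ijk. *)
Lemma derivation_diagP (l : 'rV[C]_n) :
  is_derivation mu (invmx Q *m diag_mx l *m Q) <->
  forall i j k, m i j k != 0 -> l 0 k = l 0 i + l 0 j.
Proof.
set A := invmx Q *m diag_mx l *m Q.
have QA w k : (Q *m (A *m w)) k 0 = l 0 k * (Q *m w) k 0.
  by rewrite /A !mulmxA mulmxV // mul1mx -mulmxA mul_diag_mx mxE.
have mA i j k : (Q *m (mu (A *m v i) (v j) + mu (v i) (A *m v j))) k 0 =
    (l 0 i + l 0 j) * m i j k.
  rewrite !mul_diag_eigenvector !linearZ scale_lfunE /= -scalerDl.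
  by rewrite -scalemxAr mxE.
split=> [dA i j k mijk|lm].
  apply: (mulIf mijk); rewrite -mA -dA.
  by rewrite QA.
have dv i j : A *m mu (v i) (v j) = mu (A *m v i) (v j) + mu (v i) (A *m v j).
  apply: (can_inj (mulKmx Qu)); apply/matrixP => k b; rewrite (ord1 b) mA QA.
  have [m0|/lm->//] := eqVneq (m i j k) 0.
  by rewrite -/(m i j k) m0 !mulr0.
have cols_inj (N1 N2 : 'M[C]_n) :
    (forall j, N1 *m v j = N2 *m v j) -> N1 = N2.
  move=> N12; apply: (can_inj (mulmxK (_ : invmx Q \in unitmx))).
    by rewrite unitmx_inv.
  apply/matrixP => a j; have := congr1 (fun w : 'cV_n => w a 0) (N12 j).
  by rewrite /v !colE !mulmxA -!colE !mxE.
(* The rule is known on basis vectors; it extends to the second argument through [left_mult], then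
   to the first through [right_mult]. *)
move: {QA mA} A dv => A dv.
have dL i : A *m left_mult mu (v i) =
    left_mult mu (A *m v i) + left_mult mu (v i) *m A.
  by apply: cols_inj => j; rewrite mulmxDl -!mulmxA !left_multE dv.
move=> y z; rewrite -(right_multE _ _ _ z y) mulmxA.
have -> : A *m right_mult mu z = right_mult mu z *m A + right_mult mu (A *m z).
  apply: cols_inj => i; rewrite mulmxDl -!mulmxA !right_multE.
  by rewrite -!left_multE mulmxA dL mulmxDl -mulmxA !left_multE.
by rewrite mulmxDl -mulmxA !right_multE.
Qed.
End DiagonalDerivations.

(** * The rational linear system and the conclusion *)

(** Each triple (i, j, k) gives a column e_k - e_i - e_j, or 0 when [T] fails; subtracting
    indicators stays correct when indices coincide. *)
Lemma additive_rat_mx n (T : 'I_n -> 'I_n -> 'I_n -> bool) :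
  exists p (B : 'M[rat]_(n, p)), forall (F : numFieldType) (w : 'rV[F]_n),
    w *m map_mx ratr B = 0 <->
    forall i j k, T i j k -> w 0 k = w 0 i + w 0 j.
Proof.
pose I3 := ('I_n * 'I_n * 'I_n)%type.
pose b (t : I3) (a : 'I_n) : rat :=
  if T t.1.1 t.1.2 t.2
  then (a == t.2)%:R - (a == t.1.1)%:R - (a == t.1.2)%:R else 0.
pose p := #|{: I3}|.
exists p, (\matrix_(a < n, t < p) b (enum_val t) a) => F w.
have wB t : (w *m map_mx ratr (\matrix_(a < n, t < p) b (enum_val t) a)) 0 t =
    let: (i, j, k) := enum_val t in
    if T i j k then w 0 k - w 0 i - w 0 j else 0.
  have delta i : \sum_a w 0 a * (a == i)%:R = w 0 i.
    rewrite (bigD1 i) //= eqxx mulr1 big1 ?addr0 // => a /negPf ->.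
    by rewrite mulr0.
  rewrite mxE; under eq_bigr do rewrite !mxE.
  case: (enum_val t) => [[i j] k]; rewrite /b /=; case: ifP => _.
    under eq_bigr do rewrite !rmorphB /= !rmorph_nat !mulrBr.
    by rewrite !sumrB !delta.
  by apply: big1 => a _; rewrite rmorph0 mulr0.
split=> [w0 i j k Tijk|Tw].
  have := wB (enum_rank (i, j, k)); rewrite w0 mxE enum_rankK Tijk => /esym/eqP.
  by rewrite subr_eq0 => /eqP <-; rewrite addrC subrK.
apply/rowP => t; rewrite wB mxE; case: (enum_val t) => [[i j] k].
by case: ifP => // /Tw ->; rewrite addrAC addrK subrr.
Qed.

(* When D = 0, the conclusion on char_poly forces r = 1, k_1 = 0, d_1 = n, and
   the gcd of the k_i is then 0. *)
Theorem theorem4p1 (R : realType) (n : nat) (h : hermitian_ip R n)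
    (X : n.-tuple 'cV[R[i]]_n) (hX : orthonormal h X)
    (mu : bilin R n) (hmu : critical_point h X mu)
    (c : R) (D : 'M[R[i]]_n)
    (hD : is_derivation mu D)
    (hM : Mmx h X mu = c%:C%:M + D) :
  exists (a : R) (r : nat) (k : 'I_r -> int) (d : 'I_r -> nat),
    [/\ 0 < a,
        forall i j : 'I_r, (i < j)%N -> k i < k j,
        forall i : 'I_r, (0 < d i)%N,
        char_poly (a%:C *: D) =
          \prod_(i < r) ('X - ((k i)%:~R)%:P) ^+ d i &
        (D != 0 -> \big[gcdn/0%N]_(i < r) `|k i|%N = 1%N) /\
        (symmetric_leibniz mu -> forall i : 'I_r, 0 <= k i)].
Proof.
have [mu0 _] := hmu.
have c0 := critical_const_lt0 _ _ _ _ hX _ mu0 _ _ hD hM.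
have [Q [l [Qu DE]]] :=
  selfadjoint_diag _ _ _ _ hX _ (adj_critical_derivation _ _ _ _ _ _ _ hM).
have [p [B kerB]] := additive_rat_mx n (fun i j k =>
  (Q *m mu (col i (invmx Q)) (col j (invmx Q))) k 0 != 0).
have derB (w : 'rV[R[i]]_n) : w *m map_mx ratr B = 0 <->
    is_derivation mu (invmx Q *m diag_mx w *m Q).
  by rewrite kerB; symmetry; exact: derivation_diagP.
have [x lx] : exists x : 'rV[rat]_n, l = c%:C *: map_mx ratr x.
  apply: rational_kernel_vector => [|w /derB dw].
    by apply/derB; rewrite -DE.
  have := mxtrace_derivation_Mmx _ _ h _ hX _ _ dw.
  (* M is diagonal in the same basis, so the trace of its product with the derivation is the sum of
     the w_i (l_i + c). *)
  have -> : Mmx h X mu = invmx Q *m diag_mx (l + const_mx c%:C) *m Q.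
    rewrite hM DE linearD /= mulmxDr mulmxDl addrC; congr (_ + _).
    by rewrite diag_const_mx mul_mx_scalar -scalemxAl mulVmx // scalemx1.
  rewrite mxtrace_mulC !mulmxA mulmxK // mxtrace_mulC !mulmxA mulmxV // mul1mx.
  move=> tr0.
  apply/matrixP => i j; rewrite !ord1 [RHS]mxE -[RHS]tr0 mulmx_diag.
  rewrite mxtrace_diag mxE; apply: eq_bigr => k _.
  by rewrite !mxE mulrC.
(* As c < 0, passing to [- x] makes the factor [- c * ratr q] between [l] and the integers [z]
   positive; its inverse is the required scaling. *)
have [q [z [q0 xz gcdz1]]] := rat_primitive_integer n (fun i => - x 0 i).
have lz i : l 0 i = (- c * ratr q)%:C * (z i)%:~R.
  have -> : (- c * ratr q)%:C = - c%:C * ratr q :> R[i].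
    by rewrite rmorphM rmorphN fmorph_rat.
  have -> : (z i)%:~R = ratr (z i)%:~R :> R[i] by rewrite ratr_int.
  by rewrite -mulrA -rmorphM -xz rmorphN mulrNN lx !mxE.
have b0 : 0 < - c * ratr q by rewrite mulr_gt0 ?oppr_gt0 // ltr0q.
set b := - c * ratr q in lz b0.
have [r [k [d [k_lt d_gt0 prodE kz zk]]]] :=
  prod_XsubC_group_int R[i] n z.
exists b^-1, r, k, d; split=> //; first by rewrite invr_gt0.
  have -> : b^-1%:C *: D = invmx Q *m diag_mx (b^-1%:C *: l) *m Q.
    by rewrite DE linearZ /= -scalemxAr -scalemxAl.
  rewrite char_poly_conj_diag // -prodE; apply: eq_bigr => i _.
  by rewrite mxE lz mulrA -rmorphM mulVf ?gt_eqF // mul1r.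
split=> [D0|leib i].
  have x0 : exists i, - x 0 i != 0.
    apply/existsP; apply: contraNT D0 => /existsPn xi.
    rewrite DE lx (_ : x = 0) ?map_mx0 ?scaler0 ?linear0 ?mulmx0 ?mul0mx //.
    by apply/rowP => i; move: (xi i); rewrite negbK oppr_eq0 mxE => /eqP.
  (* Every [z j] is some [k i], so the gcd of the [k i] divides that of the [z j], which is 1. *)
  apply/eqP; rewrite -dvdn1 -(gcdz1 x0); apply/dvdn_biggcdP => j _.
  by have [i <-] := zk j; exact: (@biggcdn_inf _ i).
have [j <-] := kz i.
have : 0 <= l 0 j.
  apply: (symmetric_leibniz_eigenvalue_ge0 _ _ _ _ hX _ mu0 _ _ hD hM
    (col j (invmx Q))) => //.
    (* The eigenvector is nonzero because [Q] maps it to the j-th standard basis vector. *)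
    apply/negP => /eqP v0; have := mulmxV Qu => /(congr1 (col j)).
    rewrite colE -mulmxA -colE v0 mulmx0 => /colP/(_ j).
    by rewrite !mxE eqxx => /esym/eqP; rewrite oner_eq0.
  by rewrite DE mul_diag_eigenvector.
by rewrite lz pmulr_rge0 ?ltcR // ler0z.
Qed.
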